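(* Let $A_n(x)$ denote the classical Eulerian polynomials. For every $n\geqslant 2$, the following two identities of $n\times n$ determinants hold: $$\frac{\mathrm{d}}{\mathrm{d}x} A_n(x)= \begin{vmatrix} 1 & -1 & 0 & \cdots & 0\\ \frac{\mathrm{d}}{\mathrm{d}x} A_1(x) & 2x & -1 & \cdots & 0\\ \frac{\mathrm{d}}{\mathrm{d}x} A_2(x) & 3x(1-x) & 3x & \cdots & 0\\ \vdots & \vdots & \vdots & \ddots & -1\\ \frac{\mathrm{d}}{\mathrm{d}x} A_{n-1}(x)& nx(1-x)^{n-2} & \binom n2x(1-x)^{n-3} & \cdots & nx \end{vmatrix},$$ $$\frac{\mathrm{d}}{\mathrm{d}x} A_{n-1}(x)= \begin{vmatrix} 1 & -1 & 0 & \cdots & 0\\ 1-2x & 2x & -1 & \cdots & 0\\ (1-x)(1-3x) & 3x(1-x) & 3x & \cdots & 0\\ \vdots & \vdots & \vdots & \ddots & -1\\ (1-x)^{n-2}(1-nx) & \binom n1 x(1-x)^{n-2} & \binom n2 x(1-x)^{n-3} &\cdots &\binom n{n-1}x \end{vmatrix}.$$ In both matrices, the $(i,j)$ entry for $2\leqslant j\leqslant i\leqslant n$ is $\binom{i}{j-1}x(1-x)^{i-j}$, the $(i,i+1)$ entries are $-1$, and the $(i,j)$ entries with $j>i+1$ are $0$. The $(1,1)$ entry is $1$ in both; for $2\leqslant i\leqslant n$ the $(i,1)$ entry is $\frac{\mathrm{d}}{\mathrm{d}x}A_{i-1}(x)$ in the first matrix and $(1-x)^{i-2}(1-ix)$ in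 the second.
   Context: The classical Eulerian polynomials $A_n(x)$ are defined by $A_0(x)=1$ and $A_n(x)=nxA_{n-1}(x)+x(1-x)\frac{\mathrm{d}}{\mathrm{d}x}A_{n-1}(x)$ for $n\geqslant 1$; thus $A_1(x)=x$, $A_2(x)=x+x^2$. Equivalently, $\sum_{n\geqslant 0}A_n(x)\frac{z^n}{n!}=\frac{1-x}{1-x\mathrm{e}^{(1-x)z}}$. *)

(* Defs.v *)
From mathcomp Require Import all_boot all_order all_algebra.

Set Implicit Arguments.
Unset Strict Implicit.
Unset Printing Implicit Defensive.

Import GRing.Theory.
Local Open Scope ring_scope.

Fixpoint eulerian (n : nat) : {poly int} :=
  if n is m.+1 then
    'X * eulerian m *+ m.+1 + 'X * (1 - 'X) * (eulerian m)^`()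
  else 1.

(* The n x n lower Hessenberg matrix whose (r, 1) entry is [col1 r]; rows r and
   columns c are numbered from 1, whereas the ordinals i, j start at 0. *)
Definition hessenberg_mx (col1 : nat -> {poly int}) (n : nat) :
    'M[{poly int}]_n :=
  \matrix_(i < n, j < n)
    let r := i.+1 in
    let c := j.+1 in
    if c == 1%N then col1 r
    else if (c <= r)%N then ('X * (1 - 'X) ^+ (r - c)) *+ 'C(r, c.-1)
    else if c == r.+1 then -1
    else 0.

Definition eulerian_deriv_mx (n : nat) : 'M[{poly int}]_n :=
  hessenberg_mx
    (fun r => if r == 1%N then 1 else (eulerian r.-1)^`()) n.

(* The exponent r - 2 is only used for r >= 2, where the subtraction is exact. *)
Definition eulerian_deriv_pred_mx (n : nat) : 'M[{poly int}]_n :=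
  hessenberg_mx
    (fun r => if r == 1%N then 1
              else (1 - 'X) ^+ (r - 2) * (1 - 'X *+ r)) n.

(* Main.v *)
(* The binomial sum S_n = sum_k C(n,k) (1-x)^(n-k) A_k satisfies x S_n = A_n
   for n >= 1, by induction on the defining recursion of A_n and Pascal's rule.
   Combined with x (1-x) A_n' = A_(n+1) - (n+1) x A_n, this turns the binomial
   sums of the derivatives into derivatives, which are the recurrences that
   compute the two Hessenberg determinants. *)
Require Import Defs.
From mathcomp Require Import all_boot all_order all_algebra.
From mathcomp Require Import ring.

Set Implicit Arguments.
Unset Strict Implicit.
Unset Printing Implicit Defensive.

Import GRing.Theory.
Local Open Scope ring_scope.

(* H (v_0, ..., v_n)^T = (0, ..., 0, v_(n+1))^T with v_0 = 1, so Cramer's rule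
   for the first entry reads off det H from a triangular cofactor. *)
Lemma det_lower_hessenberg (R : comNzRingType) (n : nat) (H : 'M[R]_n.+1)
    (v : nat -> R) :
  v 0%N = 1 ->
  (forall i j : 'I_n.+1, j = i.+1 :> nat -> H i j = -1) ->
  (forall i j : 'I_n.+1, (i.+1 < j)%N -> H i j = 0) ->
  (forall i : 'I_n.+1, \sum_(j < n.+1 | (j <= i)%N) H i j * v j = v i.+1) ->
  \det H = v n.+1.
Proof.
move=> v0 Hs Hz Hv.
pose w : 'cV[R]_n.+1 := \col_j v j.
have Hw (i : 'I_n.+1) : (H *m w) i 0 = if i == ord_max then v n.+1 else 0.
  rewrite mxE (bigID (fun j : 'I_n.+1 => (j <= i)%N)) /=.
  under eq_bigr => j _ do rewrite mxE.
  rewrite Hv; case: eqVneq => [-> | neq_i].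
    by rewrite big1 ?addr0 // => j; rewrite leq_ord.
  have lt_i : (i.+1 < n.+1)%N.
    rewrite ltnS ltn_neqAle -ltnS ltn_ord andbT.
    by apply: contra neq_i => /eqP e; apply/eqP/val_inj.
  (* Right of the diagonal only the superdiagonal entry survives; it contributes [- v i.+1],
     cancelling the lower part. *)
  rewrite (bigD1 (Ordinal lt_i)) /= ?ltnn // big1 ?addr0.
    by rewrite (Hs _ (Ordinal lt_i)) // !mxE mulN1r subrr.
  move=> j /andP[]; rewrite -ltnNge => lt_ij neq_j.
  rewrite Hz ?mul0r // ltn_neqAle lt_ij andbT eq_sym.
  by apply: contra neq_j => /eqP e; apply/eqP/val_inj.
have adjw : (\adj H *m (H *m w)) 0 0 = \det H.
  by rewrite mulmxA mul_adj_mx mul_scalar_mx !mxE v0 mulr1.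
rewrite -adjw mxE (bigD1 ord_max) //= big1 => [|i /negPf ne_i].
  (* Without its last row and first column, [H] is lower triangular with the superdiagonal entries
     -1 on its diagonal: the minor is (-1)^n, cancelling the cofactor sign. *)
  rewrite addr0 Hw eqxx mxE /cofactor addn0 det_trig.
    rewrite (eq_bigr (fun=> -1)) => [|i _]; last first.
      by rewrite !mxE Hs // lift0 lift_max.
    by rewrite prodr_const card_ord -exprMn mulrNN mulr1 expr1n mul1r.
  apply/is_trig_mxP => i j lt_ij.
  by rewrite !mxE Hz // lift0 lift_max.
by rewrite Hw ne_i mulr0.
Qed.

(** The share of columns 2, ..., n+1 of row n+1 (numbered from 1) in the product of [hessenberg_mx]
    with the vector f. *)
Definition hessenberg_row_sum (f : nat -> {poly int}) (n : nat) : {poly int} :=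
  \sum_(1 <= k < n.+1) ('X * (1 - 'X) ^+ (n - k)) *+ 'C(n.+1, k) * f k.

Lemma det_hessenberg_mx (col1 v : nat -> {poly int}) (n : nat) :
  v 0%N = 1 ->
  (forall i, (i <= n)%N -> col1 i.+1 + hessenberg_row_sum v i = v i.+1) ->
  \det (hessenberg_mx col1 n.+1) = v n.+1.
Proof.
move=> v0 Hv; apply: (det_lower_hessenberg v0) => [i j e|i j lt_ij|i].
- by rewrite mxE e /= eqxx ltnn.
- rewrite mxE /= ltnNge (ltnW lt_ij) /= !eqSS (gtn_eqF lt_ij).
  by case: (j : nat) lt_ij.
rewrite -Hv; last by rewrite -ltnS.
rewrite (big_ord_narrow_leq (leq_ord i)) big_ord_recl mxE v0 mulr1.
congr (_ + _); rewrite /hessenberg_row_sum big_add1 /= big_mkord.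
by apply: eq_bigr => j _; rewrite mxE /bump /= add1n !ltnS ltn_ord subSS.
Qed.

(** On exponential generating functions in z this is multiplication by exp((1-x)z). The rules below
    are the product rule in z and in x, and the action of z and of z d/dz. *)
Definition binom_sum (f : nat -> {poly int}) (n : nat) : {poly int} :=
  \sum_(k < n.+1) ((1 - 'X) ^+ (n - k) * f k) *+ 'C(n, k).

Lemma binom_sumS f n :
  binom_sum f n.+1 = (1 - 'X) * binom_sum f n + binom_sum (f \o succn) n.
Proof.
rewrite /binom_sum big_ord_recl /= !bin0.
under eq_bigr => k _ do rewrite /bump /= add1n subSS binS mulrnDr.
rewrite big_split addrA; congr (_ + _).
(* The added top term k = n+1 vanishes because C(n, n+1) = 0. *)
transitivity (\sum_(k < n.+2) ((1 - 'X) ^+ (n.+1 - k) * f k) *+ 'C(n, k)).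
  by rewrite [in RHS]big_ord_recl /= bin0; congr (_ + _).
rewrite big_ord_recr /= bin_small // mulr0n addr0 mulr_sumr.
by apply: eq_bigr => k _; rewrite subSn -1?ltnS // exprS mulrnAr mulrA.
Qed.

Lemma deriv_binom_sum f n :
  (binom_sum f n.+1)^`() =
  binom_sum (fun k => (f k)^`()) n.+1 - binom_sum f n *+ n.+1.
Proof.
rewrite /binom_sum raddf_sum big_ord_recr [in RHS]big_ord_recr /=.
rewrite subnn !expr0 !mul1r binn [RHS]addrAC; congr (_ + _).
rewrite -sumrMnl -sumrB; apply: eq_bigr => k _.
have le_kn : (k <= n)%N by rewrite -ltnS.
have bin_down : ('C(n.+1, k) * (n - k).+1 = n.+1 * 'C(n, k))%N.
  by rewrite mulnC -subSn // -mul_bin_down.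
rewrite derivMn derivM deriv_exp derivB derivC derivX subSn //=.
rewrite sub0r mulN1r mulNrn mulNr mulrnDl addrC mulNrn; congr (_ - _).
by rewrite mulrnAl -!mulrnA mulnC bin_down mulnC.
Qed.

Lemma binom_sum_absorb f n :
  binom_sum (fun k => f k.-1 *+ k) n.+1 = binom_sum f n *+ n.+1.
Proof.
rewrite /binom_sum big_ord_recl mulr0n mulr0 mul0rn add0r -sumrMnl.
apply: eq_bigr => k _; rewrite /= /bump /= add1n subSS mulrnAr -!mulrnA.
by rewrite -(mul_bin_diag n.+1 k) mulnC.
Qed.

Lemma eq_binom_sum f g n : f =1 g -> binom_sum f n = binom_sum g n.
Proof. by move=> fg; apply: eq_bigr => k _; rewrite fg. Qed.

Lemma binom_sumD f g n :
  binom_sum (fun k => f k + g k) n = binom_sum f n + binom_sum g n.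
Proof.
by rewrite -big_split /=; apply: eq_bigr => k _; rewrite mulrDr mulrnDl.
Qed.

Lemma binom_sumMl c f n : binom_sum (fun k => c * f k) n = c * binom_sum f n.
Proof.
by rewrite mulr_sumr; apply: eq_bigr => k _; rewrite mulrCA mulrnAr.
Qed.

Lemma binom_sum_weight f n :
  binom_sum (fun k => f k *+ k) n.+1 =
  (binom_sum f n.+1 - (1 - 'X) * binom_sum f n) *+ n.+1.
Proof.
rewrite [X in X - _]binom_sumS addrC addKr -binom_sum_absorb.
by apply: eq_binom_sum => -[|k].
Qed.

Lemma eulerianS n :
  eulerian n.+1 =
  'X * eulerian n *+ n.+1 + 'X * (1 - 'X) * (eulerian n)^`().
Proof. by []. Qed.

(** Split the factor k+1 of the recursion as 1 + k. The lower sums S_n produced by the weight k and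
    by the derivative cancel, so S obeys the recursion of A. *)
Lemma binom_sum_eulerian_succ n :
  binom_sum (eulerian \o succn) n.+1 =
  'X * binom_sum eulerian n.+1 *+ n.+2 +
  'X * (1 - 'X) * (binom_sum eulerian n.+1)^`().
Proof.
rewrite deriv_binom_sum.
rewrite (@eq_binom_sum _ (fun k => 'X * eulerian k + 'X * (eulerian k *+ k) +
  'X * (1 - 'X) * (eulerian k)^`())); last first.
  by move=> k /=; rewrite mulrS mulrnAr.
rewrite !binom_sumD !binom_sumMl binom_sum_weight; ring.
Qed.

Lemma eulerian_binom_sum n : 'X * binom_sum eulerian n.+1 = eulerian n.+1.
Proof.
elim: n => [|n IHn].
  rewrite binom_sumS /binom_sum !big_ord1 subnn bin0 /= derivC; ring.
(* The extra S from differentiating x S matches the (1-x) S of Pascal's rule. *)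
rewrite binom_sumS binom_sum_eulerian_succ eulerianS -IHn derivM derivX; ring.
Qed.

Lemma polyX_int_neq0 : 'X != 0 :> {poly int}.
Proof. by rewrite polyX_eq0. Qed.

Lemma one_subX_neq0 : 1 - 'X != 0 :> {poly int}.
Proof. by rewrite -opprB oppr_eq0 polyXsubC_eq0. Qed.

(** Differentiate x S_(n+2) = A_(n+2). A further factor x lets every S be replaced by A, and the
    recursion then yields A'_(n+1). *)
Lemma binom_sum_deriv_eulerian n :
  'X * binom_sum (fun k => (eulerian k)^`()) n.+2 =
  (eulerian n.+2)^`() - (1 - 'X) * (eulerian n.+1)^`().
Proof.
apply: (mulfI polyX_int_neq0).
have dE := congr1 (fun p => p^`()) (eulerian_binom_sum n.+1).
rewrite derivM derivX mul1r deriv_binom_sum in dE.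
have E := eulerian_binom_sum n.+1; rewrite [RHS]eulerianS in E.
rewrite -dE; set SD := binom_sum _ n.+2.
transitivity ('X * ('X * SD) + ('X * binom_sum eulerian n.+2
    - 'X * ('X * binom_sum eulerian n.+1) *+ n.+2
    - 'X * (1 - 'X) * (eulerian n.+1)^`())); last by ring.
rewrite E eulerian_binom_sum; ring.
Qed.

Lemma binom_sum_delta0 n : binom_sum (fun k => (k == 0)%N%:R) n = (1 - 'X) ^+ n.
Proof.
rewrite /binom_sum big_ord_recl big1 => [|k _]; last by rewrite mulr0 mul0rn.
by rewrite /= bin0 subn0 mulr1 addr0.
Qed.

Lemma binom_sum_le1 n :
  binom_sum (fun k => (k <= 1)%N%:R) n.+1 =
  (1 - 'X) ^+ n.+1 + (1 - 'X) ^+ n *+ n.+1.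
Proof.
rewrite /binom_sum !big_ord_recl big1 => [|k _]; last by rewrite mulr0 mul0rn.
by rewrite /= bin0 bin1 subn0 subSS subn0 !mulr1 addr0.
Qed.

(** Take binomial sums of A_k = x(1-x) A'_(k-1) + k x A_(k-1) + [k = 0]; the indicator accounts for
    A_0 = 1 and gives the power of 1-x. *)
Lemma binom_sum_deriv_eulerian_pred n :
  'X * binom_sum (fun k => (eulerian k.-1)^`()) n.+2 =
  (eulerian n.+1)^`() - (1 - 'X) ^+ n.+1.
Proof.
apply: (mulfI (mulf_neq0 polyX_int_neq0 one_subX_neq0)).
set SD := binom_sum _ _.
have SDE : binom_sum eulerian n.+2 = 'X * (1 - 'X) * SD
    + 'X * (binom_sum eulerian n.+1 *+ n.+2) + (1 - 'X) ^+ n.+2.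
  rewrite -binom_sum_absorb -binom_sum_delta0 -!binom_sumMl -!binom_sumD.
  apply: eq_binom_sum => -[|k].
    by rewrite /= derivC mulr0 mulr0n mulr0 !add0r.
  by rewrite eulerianS /= addr0 addrC mulrnAr.
have E := eulerian_binom_sum n.+1; rewrite [RHS]eulerianS SDE in E.
transitivity ('X * ('X * (1 - 'X) * SD + 'X * (binom_sum eulerian n.+1 *+ n.+2)
  + (1 - 'X) ^+ n.+2) - 'X * ('X * binom_sum eulerian n.+1) *+ n.+2
  - 'X * (1 - 'X) ^+ n.+2); first by ring.
rewrite E eulerian_binom_sum exprS; ring.
Qed.

(** The factor 1-x raises each exponent n-k to n+1-k, leaving a full binomial sum without its two
    end terms. *)
Lemma hessenberg_row_sumE f n :
  (1 - 'X) * hessenberg_row_sum f n =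
  'X * (binom_sum f n.+1 - (1 - 'X) ^+ n.+1 * f 0%N - f n.+1).
Proof.
rewrite /binom_sum big_ord_recr big_ord_recl /= bin0 binn subnn subn0 !mulr1n.
rewrite expr0 mul1r [_ + _ - _ * _]addrAC addrK [_ + \sum_(_ < _) _]addrC addrK.
rewrite /hessenberg_row_sum big_add1 /=.
rewrite big_mkord !mulr_sumr; apply: eq_bigr => k _.
rewrite /bump /= add1n subSS -[in RHS](subnSK (ltn_ord k)) exprS.
by rewrite !mulrnAl !mulrnAr !mulrA (mulrC (1 - 'X)) -!mulrA.
Qed.

Lemma hessenberg_row_sum0 f : hessenberg_row_sum f 0 = 0.
Proof. by rewrite /hessenberg_row_sum big_geq. Qed.

Lemma eq_hessenberg_row_sum f g n :
  (forall k, f k.+1 = g k.+1) ->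
  hessenberg_row_sum f n = hessenberg_row_sum g n.
Proof.
move=> fg; rewrite /hessenberg_row_sum !big_add1.
by apply: eq_bigr => k _; rewrite fg.
Qed.

Lemma det_eulerian_deriv_mx n :
  \det (eulerian_deriv_mx n.+1) = (eulerian n.+1)^`().
Proof.
pose D k := (eulerian k)^`().
(* The value at 0 must be 1 whereas [D 0] is 0; row sums start at k = 1, so [D] can replace this
   vector inside them. *)
apply: (det_hessenberg_mx (v := fun k => if k is 0 then 1 else D k)) => // -[_|i _].
  rewrite hessenberg_row_sum0 /D eulerianS derivD /= derivC !mulr0 mulr1.
  by rewrite derivC derivX !addr0.
rewrite (@eq_hessenberg_row_sum _ D) // -[X in X + _]/(D i.+1).
apply: (mulfI one_subX_neq0); rewrite mulrDr hessenberg_row_sumE.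
have D0 : D 0%N = 0 by rewrite /D derivC.
rewrite D0 mulr0 subr0 [X in _ + X]mulrBr.
rewrite (binom_sum_deriv_eulerian i : 'X * binom_sum D i.+2 = _).
rewrite /D; ring.
Qed.

Lemma det_eulerian_deriv_pred_mx n :
  \det (eulerian_deriv_pred_mx n.+2) = (eulerian n.+1)^`().
Proof.
pose D k := (eulerian k.-1)^`().
(* Normalization and the first row force v_0 = v_1 = 1, but [D] vanishes at both indices. *)
pose v k := D k + (k <= 1)%N%:R.
have D0 : D 0%N = 0 by rewrite /D derivC.
have D1 : D 1%N = 0 by rewrite /D derivC.
(* The added 0 is the indicator in [v] at index n+2. *)
rewrite -[RHS]addr0; apply: (det_hessenberg_mx (v := v)) => [|[_|i _]].
- by rewrite /v D0 add0r.
- by rewrite hessenberg_row_sum0 /v D1 add0r addr0.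
apply: (mulfI one_subX_neq0); rewrite mulrDr hessenberg_row_sumE.
rewrite {2}/v D0 binom_sumD binom_sum_le1 /v /= addr0 add0r mulr1 subSS subSS subn0.
transitivity ((1 - 'X) * ((1 - 'X) ^+ i * (1 - 'X *+ i.+2))
  + ('X * binom_sum D i.+2 + 'X * (1 - 'X) ^+ i.+1 *+ i.+2 - 'X * D i.+2)).
  ring.
rewrite (binom_sum_deriv_eulerian_pred i : 'X * binom_sum D i.+2 = _).
rewrite /D /= exprS; ring.
Qed.

Theorem corollary2p3 (n : nat) (hn : (2 <= n)%N) :
  (eulerian n)^`() = \det (eulerian_deriv_mx n) /\
  (eulerian n.-1)^`() = \det (eulerian_deriv_pred_mx n).
Proof.
case: n hn => [|[|n]] // _.
by rewrite det_eulerian_deriv_mx det_eulerian_deriv_pred_mx.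
Qed.
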